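(* Let $p,q\in(0,1)$ with $p\neq q$ and $t>0$ be fixed, and let $$t_c(p,q)=\frac{2}{(\sqrt p-\sqrt q)^2+(\sqrt{1-q}-\sqrt{1-p})^2}.$$ Let $(\sigma_0,G)$ be drawn from the symmetric censored stochastic block model $\mathrm{CSBM}(p,q,\alpha)$ on $n$ vertices with $\alpha=t\log n/n$. If $t<t_c(p,q)$, then any estimator $\hat\sigma$ satisfies $\mathbb{P}(\hat\sigma=\sigma_0)=o(1)$ as $n\to\infty$.
   Context: Symmetric censored stochastic block model $\mathrm{CSBM}(p,q,\alpha)$ on vertex set $[n]$: the labels $\sigma_0(i)\in\{\pm1\}$, $i\in[n]$, are i.i.d. uniform. Given $\sigma_0$, independently over unordered pairs $i\ne j$, there is an edge between $i$ and $j$ with probability $p$ if $\sigma_0(i)=\sigma_0(j)$ and with probability $q$ if $\sigma_0(i)\neq\sigma_0(j)$ (no self-loops). Independently over pairs, the status (edge or non-edge) of each pair is revealed with probability $\alpha=t\log n/n$ ($n$ large enough that $\alpha\le 1$). The observation $G$ assigns to each pair a status in {present, absent, censored}: ''present'' if revealed and an edge, ''absent'' if revealed and a non-edge, ''censored'' if not revealed. An estimator $\hat\sigma\in\{\pm1\}^n$ is a (possibly randomized) function of $G$ only; $\sigma_0$ is not observed. $\log$ is the natural logarithm. *)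

(* Defs.v *)
From HB Require Import structures.
From mathcomp Require Import all_boot all_order all_algebra.
From mathcomp Require Import all_classical all_reals all_analysis.

Set Implicit Arguments.
Unset Strict Implicit.
Unset Printing Implicit Defensive.

Import Order.TTheory GRing.Theory Num.Theory.
Import numFieldNormedType.Exports.
Local Open Scope ring_scope.

(* Unordered pairs {i, j} with i != j, represented by their increasing
   enumeration. *)
Definition vpair (n : nat) := {x : 'I_n * 'I_n | (x.1 < x.2)%N}.

(* The label +1 is encoded by [true], the label -1 by [false]. *)
Definition labels (n : nat) := {ffun 'I_n -> bool}.

(* [Some true] = present, [Some false] = absent, [None] = censored. *)
Definition observation (n : nat) := {ffun vpair n -> option bool}.

(* A point ((s, e), r) of the latent sample space: the labels s, the edge
   indicators e, and the indicators r of the pairs that are revealed. *)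
Definition latent (n : nat) :=
  (labels n * {ffun vpair n -> bool} * {ffun vpair n -> bool})%type.

Definition hidden_labels n (w : latent n) : labels n := w.1.1.

Definition censored_graph n (w : latent n) : observation n :=
  [ffun x => if w.2 x then Some (w.1.2 x) else None].

(* This is a probability mass function when p, q and a all lie in [0, 1]. *)
Definition csbm_pmf (R : realType) (p q a : R) n (w : latent n) : R :=
  let: (s, e, r) := w in
  (\prod_(i < n) bernoulli_pmf 2^-1 (s i)) *
  (\prod_(x : vpair n)
     bernoulli_pmf (if s (val x).1 == s (val x).2 then p else q) (e x)) *
  (\prod_(x : vpair n) bernoulli_pmf a (r x)).

(* A possibly randomized function of the observation: given G, the output is
   drawn from [est_kernel G] by randomness independent of the latent
   variables. *)
Record estimator (R : realType) (n : nat) := Estimator {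
  est_kernel : observation n -> labels n -> R;
  est_kernel_ge0 : forall G s, 0 <= est_kernel G s;
  est_kernel_sum1 : forall G, \sum_(s : labels n) est_kernel G s = 1 }.

(* The probability that the estimator outputs exactly the hidden labels (not
   merely up to a global sign). *)
Definition recovery_prob (R : realType) (p q a : R) n (f : estimator R n) : R :=
  \sum_(w : latent n)
    csbm_pmf p q a w * est_kernel f (censored_graph w) (hidden_labels w).

(* May exceed 1 for finitely many n, which does not affect limits in n. *)
Definition reveal_rate (R : realType) (t : R) (n : nat) : R :=
  t * ln n%:R / n%:R.

Definition t_c (R : realType) (p q : R) : R :=
  2 / ((Num.sqrt p - Num.sqrt q) ^+ 2 +
       (Num.sqrt (1 - q) - Num.sqrt (1 - p)) ^+ 2).

(* Main.v *)
(* Let L_i be the likelihood ratio of the labels flipped at vertex i, and let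
   S be the sum over i of min(1, L_i).  Since min(1, L_i) times the
   likelihood is at most the likelihood of the flipped labels, and an estimator
   outputs at most one of the n flips, E[1_success S] <= 1.  So recovery is
   unlikely once S, given the labels, concentrates around a mean that tends to
   infinity.
   Concentration: two scores share a single pair, which is revealed with
   probability tending to 0, so their correlation is negligible.
   Mean: E min(1, L_i) is the Hellinger affinity n^(-t / t_c + o(1)) of the two
   laws times the mean of exp(-|log L_i| / 2) under the normalised geometric
   mean of these laws; there log L_i is o(log n) in mean square as soon as the
   two communities are nearly balanced.  Hence the mean of S is
   n^(1 - t / t_c + o(1)). *)

Require Import Defs.
From HB Require Import structures.
From mathcomp Require Import all_boot all_order all_algebra.
From mathcomp Require Import all_classical all_reals all_analysis.
From mathcomp Require Import ring lra.

Import Order.TTheory GRing.Theory Num.Theory.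
Import numFieldNormedType.Exports.
Local Open Scope classical_set_scope.
Local Open Scope ring_scope.

(** * Expectations under finite product laws *)

Section ProductExpectation.
Context {R : realType} {X T : finType}.
Implicit Types (w : X -> T -> R) (F : {ffun X -> T} -> R) (A : pred X).

Definition prod_mass w (G : {ffun X -> T}) : R := \prod_x w x (G x).

Definition expect w F : R := \sum_G prod_mass w G * F G.

Definition depends_on A F :=
  forall G H : {ffun X -> T}, (forall x, A x -> G x = H x) -> F G = F H.

Lemma sum_prod_mass w : \sum_G prod_mass w G = \prod_x \sum_o w x o.
Proof. by rewrite bigA_distr_bigA. Qed.

Lemma prod_mass_ge0 w G : (forall x o, 0 <= w x o) -> 0 <= prod_mass w G.
Proof. by move=> w0; apply: prodr_ge0. Qed.

Lemma prod_mass_sum1 w :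
  (forall x, \sum_o w x o = 1) -> \sum_G prod_mass w G = 1.
Proof. by move=> w1; rewrite sum_prod_mass big1. Qed.

Lemma expect_cst w c : (forall x, \sum_o w x o = 1) -> expect w (fun=> c) = c.
Proof. by move=> w1; rewrite /expect -mulr_suml prod_mass_sum1// mul1r. Qed.

Lemma expectD w F1 F2 :
  expect w (fun G => F1 G + F2 G) = expect w F1 + expect w F2.
Proof. by rewrite -big_split; apply: eq_bigr => G _; rewrite mulrDr. Qed.

Lemma expectZ w c F : expect w (fun G => c * F G) = c * expect w F.
Proof. by rewrite mulr_sumr; apply: eq_bigr => G _; rewrite mulrCA. Qed.

Lemma expect_sum (I : finType) (P : pred I) w (F : I -> {ffun X -> T} -> R) :
  expect w (fun G => \sum_(i | P i) F i G) = \sum_(i | P i) expect w (F i).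
Proof.
by rewrite exchange_big; apply: eq_bigr => G _; rewrite mulr_sumr.
Qed.

Lemma eq_expect w F1 F2 : F1 =1 F2 -> expect w F1 = expect w F2.
Proof. by move=> eF; apply: eq_bigr => G _; rewrite eF. Qed.

Lemma eq_expect_law {w v} : w =2 v -> forall F, expect w F = expect v F.
Proof.
by move=> wv F; apply: eq_bigr => G _; congr (_ * _); apply: eq_bigr => x _.
Qed.

Lemma le_expect w F1 F2 : (forall x o, 0 <= w x o) ->
  (forall G, F1 G <= F2 G) -> expect w F1 <= expect w F2.
Proof.
by move=> w0 le12; apply: ler_sum => G _; rewrite ler_wpM2l// prod_mass_ge0.
Qed.

Lemma expect_ge0 w F : (forall x o, 0 <= w x o) -> (forall G, 0 <= F G) ->
  0 <= expect w F.
Proof.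
by move=> w0 F0; apply: sumr_ge0 => G _; rewrite mulr_ge0// prod_mass_ge0.
Qed.

Definition mix A (u : {ffun X -> T} * {ffun X -> T}) :
    {ffun X -> T} * {ffun X -> T} :=
  ([ffun x => if A x then u.1 x else u.2 x],
   [ffun x => if A x then u.2 x else u.1 x]).

Lemma mixK A : involutive (mix A).
Proof.
by case=> G H; congr (_, _); apply/ffunP => x; rewrite !ffunE; case: (A x).
Qed.

(* Take two independent copies of the configuration and exchange their
   coordinates outside A: the joint law is preserved, while F1 and F2, which
   were evaluated on different copies, are now evaluated on the same one. *)
Lemma expectM w A F1 F2 : (forall x, \sum_o w x o = 1) ->
  depends_on A F1 -> depends_on (predC A) F2 ->
  expect w (fun G => F1 G * F2 G) = expect w F1 * expect w F2.
Proof.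
move=> w1 dF1 dF2.
rewrite -[LHS]mulr1 -(prod_mass_sum1 w w1) /expect !big_distrlr /=.
rewrite !pair_bigA /= [RHS](reindex_inj (inv_inj (mixK A))).
apply: eq_bigr => -[G H] _ /=.
have -> : F1 [ffun x => if A x then G x else H x] = F1 G.
  by apply: dF1 => x Ax; rewrite ffunE Ax.
have -> : F2 [ffun x => if A x then H x else G x] = F2 G.
  by apply: dF2 => x /negPf /= Ax; rewrite ffunE Ax.
rewrite [LHS]mulrAC [RHS]mulrACA; congr (_ * _).
rewrite -!big_split; apply: eq_bigr => x _ /=.
by rewrite !ffunE; case: (A x); rewrite // mulrC.
Qed.

Lemma expect_coord w x (f : T -> R) : (forall y, \sum_o w y o = 1) ->
  expect w (fun G => f (G x)) = \sum_o w x o * f o.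
Proof.
(* Absorbing [f] into the weight at [x] turns the expectation into the total mass of a product
   weight, which factorises. *)
move=> w1; pose v y o := w y o * (if y == x then f o else 1).
transitivity (\sum_G prod_mass v G).
  apply: eq_bigr => G _; rewrite /prod_mass /v big_split /=; congr (_ * _).
  by rewrite (bigD1 x)//= eqxx big1 ?mulr1// => y /negPf ->.
rewrite sum_prod_mass (bigD1 x)//= [X in _ * X]big1 => [|y /negPf yx].
  by rewrite mulr1; apply: eq_bigr => o _; rewrite /v eqxx.
rewrite /v yx.
by rewrite -[RHS](w1 y); apply: eq_bigr => o _; rewrite mulr1.
Qed.

(** Off the diagonal, independence factors the terms into products of means. The squared means
    missing on the diagonal are nonnegative, so completing the square of the sum only enlarges the
    bound. *)
Lemma second_moment_sum w (f : X -> T -> R) :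
  (forall x o, 0 <= w x o) -> (forall y, \sum_o w y o = 1) ->
  expect w (fun G => (\sum_x f x (G x)) ^+ 2) <=
  \sum_x \sum_o w x o * f x o ^+ 2 + (\sum_x \sum_o w x o * f x o) ^+ 2.
Proof.
move=> w0 w1; pose m x := \sum_o w x o * f x o.
rewrite (eq_expect w _
  (fun G => \sum_x \sum_y f x (G x) * f y (G y))); last first.
  by move=> G; rewrite expr2 big_distrlr.
rewrite expect_sum expr2 big_distrlr -big_split /=.
apply: ler_sum => x _; rewrite expect_sum (bigD1 x)//= lerD//.
  by rewrite (expect_coord w x (fun o => f x o * f x o)).
rewrite [leRHS](bigD1 x)//= ler_wpDl ?sqr_ge0 -?expr2 ?sqr_ge0//.
apply: ler_sum => y yx.
rewrite (expectM w (pred1 x) (fun G => f x (G x)) (fun G => f y (G y)))//.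
- by rewrite (expect_coord w x)// (expect_coord w y).
- by move=> G H /(_ x) -> /=.
- by move=> G H /(_ y) -> /=.
Qed.

(* The geometric mean of a product law w and of w * exp Y is proportional to
   the product law q, and min(1, exp Y) is exp(Y/2) * exp(-|Y|/2); Jensen's
   inequality under q then bounds the second factor. *)
Lemma expect_min_expR_ge w (y : X -> T -> R) (z : X -> R) (q : X -> T -> R)
    (c : R) :
  0 < c -> (forall x o, 0 <= q x o) -> (forall x, \sum_o q x o = 1) ->
  (forall x o, w x o * expR (y x o / 2) = z x * q x o) ->
  (forall x, 0 <= z x) -> (forall x o, 0 <= w x o) ->
  (\prod_x z x) *
    expR (- (c / 4 + expect q (fun G => (\sum_x y x (G x)) ^+ 2) / (4 * c))) <=
  expect w (fun G => Num.min 1 (expR (\sum_x y x (G x)))).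
Proof.
move=> c0 q0 q1 wq z0 w0; set m := - _.
pose Y G := \sum_x y x (G x).
(* By AM-GM [v G] is at most -|Y|/2. This quadratic surrogate has a mean that involves only the
   second moment of [Y], and [c] stays free for later optimisation. *)
pose v (G : {ffun X -> T}) := - (c / 4 + Y G ^+ 2 / (4 * c)).
have vm : expect q v = m.
  rewrite /v (eq_expect _ _ (fun G => - (c / 4) + - (4 * c)^-1 * Y G ^+ 2)).
    by rewrite expectD expect_cst// expectZ /m opprD mulNr [_^-1 * _]mulrC.
  by move=> G; rewrite opprD mulNr [_^-1 * _]mulrC.
(* Jensen's inequality, from the tangent line of the exponential at the mean [m]. *)
have jensen : expR m <= expect q (fun G => expR (v G)).
  have -> : expR m = expect q (fun G => expR m * (1 - m) + expR m * v G).
    rewrite expectD expect_cst// expectZ vm; ring.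
  apply: le_expect => // G.
  have -> : v G = m + (v G - m) by ring.
  rewrite expRD -mulrDr ler_wpM2l ?expR_ge0//.
  by have := expR_ge1Dx (v G - m); lra.
apply: (le_trans (ler_wpM2l _ jensen)); first exact: prodr_ge0.
rewrite /expect mulr_sumr; apply: ler_sum => G _.
have wqG : prod_mass w G * expR (Y G / 2) = (\prod_x z x) * prod_mass q G.
  rewrite /prod_mass /Y mulr_suml expR_sum -!big_split /=.
  exact: eq_bigr.
rewrite mulrA -wqG -mulrA ler_wpM2l ?prod_mass_ge0// -expRD.
have hv : Y G / 2 + v G <= 0 /\ Y G / 2 + v G <= Y G.
  have e1 : 4 * c * (c / 4 + Y G ^+ 2 / (4 * c)) = c ^+ 2 + Y G ^+ 2.
    by field; rewrite gt_eqF.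
  rewrite /v; set r := c / 4 + _ in e1 *.
  have := sqr_ge0 (Y G - c); have := sqr_ge0 (Y G + c).
  split; nra.
by rewrite le_min expR_le1 ler_expR; apply/andP.
Qed.

End ProductExpectation.

(** Integrates out two independent product families, here edges and revelations with [h] the
    censoring map. Expanding the product law on the right, each pair [(e, r)] is compatible with
    exactly one configuration [G]. *)
Lemma expect_pushforward2 {R : realType} {X T1 T2 T : finType}
    (u : X -> T1 -> R) (v : X -> T2 -> R) (h : T1 -> T2 -> T)
    (F : {ffun X -> T} -> R) :
  \sum_(e : {ffun X -> T1}) \sum_(r : {ffun X -> T2})
    (\prod_x u x (e x)) * (\prod_x v x (r x)) * F [ffun x => h (e x) (r x)] =
  expect (fun x o => \sum_b \sum_c if h b c == o then u x b * v x c else 0) F.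
Proof.
pose k (G : {ffun X -> T}) x b c := if h b c == G x then u x b * v x c else 0.
transitivity (\sum_(G : {ffun X -> T})
    \sum_(e : {ffun X -> T1}) \sum_(r : {ffun X -> T2})
      (\prod_x k G x (e x) (r x)) * F G); last first.
  apply: eq_bigr => G _; rewrite /prod_mass bigA_distr_bigA /= mulr_suml.
  apply: eq_bigr => e _; rewrite bigA_distr_bigA /= mulr_suml.
  exact: eq_bigr.
rewrite [RHS]exchange_big; apply: eq_bigr => e _.
rewrite [RHS]exchange_big; apply: eq_bigr => r _ /=.
rewrite [RHS](bigD1 [ffun x => h (e x) (r x)])//= [X in _ + X]big1 => [|G neG].
  rewrite addr0 -big_split; congr (_ * _).
  by apply: eq_bigr => x _; rewrite /k ffunE eqxx.
have [x hx] : exists x, h (e x) (r x) != G x.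
  apply/existsP; rewrite -negb_forall; apply: contra neG => /forallP eG.
  by apply/eqP/ffunP => x; rewrite ffunE -(eqP (eG x)).
by rewrite (bigD1 x)//= /k (negPf hx) !mul0r.
Qed.

(** Meant for means [E i] and mixed moments [EE i j] of variables in [0, 1]: the diagonal costs only
    the sum of the means, and the remaining terms nearly factor. Keeping [c] and [d] apart avoids
    divisions. *)
Lemma ler_second_moment {R : numDomainType} {I : finType} (E : I -> R)
    (EE : I -> I -> R) (c d : R) : 0 <= c -> 0 <= d -> (forall i, 0 <= E i) ->
  (forall i, EE i i <= E i) ->
  (forall i j, i != j -> c * EE i j <= d * (E i * E j)) ->
  c * (\sum_i \sum_j EE i j) <= c * (\sum_i E i) + d * (\sum_i E i) ^+ 2.
Proof.
move=> c0 d0 E0 EEd EEo; rewrite expr2 big_distrlr !mulr_sumr -big_split /=.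
apply: ler_sum => i _; rewrite !mulr_sumr (bigD1 i)//= lerD ?ler_wpM2l//.
rewrite [leRHS](bigD1 i)//= ler_wpDl ?mulr_ge0//.
by apply: ler_sum => j ji; apply: EEo; rewrite eq_sym.
Qed.

(** * Pairs of vertices and single-vertex flips *)

Section Pairs.
Context {n : nat}.
Implicit Types (i j : 'I_n) (x : vpair n) (s : labels n).

Definition same_label s x := s (val x).1 == s (val x).2.

Definition incident i x := ((val x).1 == i) || ((val x).2 == i).

Definition flip i s : labels n := [ffun j => (j == i) (+) s j].

Lemma flipK i : involutive (flip i).
Proof. by move=> s; apply/ffunP => j; rewrite !ffunE addKb. Qed.

Lemma flip_inj s : injective (flip^~ s).
Proof.
move=> i j /ffunP/(_ i); rewrite !ffunE eqxx.
by case: eqP => // _; case: (s i).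
Qed.

Lemma same_label_flip i s x :
  same_label (flip i s) x = incident i x (+) same_label s x.
Proof.
case: x => -[j k] /= jk; rewrite /same_label /incident /= !ffunE.
have [ji|_] := eqVneq j i; have [ki|_] := eqVneq k i => //=.
- by move: jk; rewrite ji ki ltnn.
- by case: (s j); case: (s k).
- by case: (s j); case: (s k).
Qed.

(** Once the pair {i, j} is set aside, the scores of [i] and [j] depend on disjoint sets of
    pairs. *)
Lemma common_pair i j : i != j ->
  exists x0, forall x, incident i x -> incident j x -> x = x0.
Proof.
wlog ij : i j / (i < j)%N.
  move=> H ij; case: (ltngtP i j) => [|ji|/val_inj e]; first by move/H; apply.
  - have [|x0 hx0] := H j i ji; first by rewrite eq_sym.
    by exists x0 => x ? ?; apply: hx0.
  - by rewrite e eqxx in ij.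
move=> _; exists (exist _ (i, j) ij) => -[[k l] /= kl] ik jk.
apply: val_inj => /=.
move: ik jk; rewrite /incident /= => ik jk.
case/orP: ik => /eqP ei; case/orP: jk => /eqP ej; move: ij;
  rewrite -ei -ej ?ltnn//.
by move=> /ltnW; rewrite leqNgt kl.
Qed.

Lemma big_incident (V : Type) (idx : V) (op : Monoid.com_law idx) i
    (F : 'I_n -> 'I_n -> V) : (forall j k, F j k = F k j) ->
  \big[op/idx]_(x : vpair n | incident i x) F (val x).1 (val x).2 =
  \big[op/idx]_(j | j != i) F i j.
Proof.
move=> FC.
pose P (u : 'I_n * 'I_n) := (u.1 < u.2)%N && ((u.1 == i) || (u.2 == i)).
transitivity (\big[op/idx]_(u | P u) F u.1 u.2).
  rewrite [RHS](reindex_omap (val : vpair n -> _) insub) => [|u /andP[ltu _]].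
    apply: eq_bigl => x; rewrite /P (valP x) /= valK eqxx andbT //.
  by rewrite insubT.
rewrite -(pair_big_dep xpredT (fun j k => P (j, k)) F) /=.
(* Row [i] supplies the endpoints above [i]; every row [j < i] supplies the single entry [k = i];
   the rows above [i] are empty. *)
rewrite (bigD1 i)//= [RHS](bigID (fun j => i < j)%N) /=; congr (op _ _).
  apply: eq_bigl => j; rewrite /P /= eqxx andbT -val_eqE /=.
  by case: ltngtP.
rewrite [RHS]big_mkcond [LHS]big_mkcond; apply: eq_bigr => j _.
have [->|ji] := eqVneq j i => //=.
rewrite -leqNgt leq_eqVlt val_eqE (negPf ji) /= FC.
rewrite (eq_bigl (fun k => (k == i) && (j < i)%N)) => [|k].
  have [ltji|_] := boolP (j < i)%N; last first.
    by rewrite big_pred0// => k; rewrite andbF.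
  by under eq_bigl do rewrite andbT; rewrite big_pred1_eq FC.
by rewrite /P /= (negPf ji) /=; case: eqVneq => [->|]; rewrite ?andbT ?andbF.
Qed.

End Pairs.

(** * Observation law given the labels, and likelihood ratios of flips *)

Section CensoredModel.
Context {R : realType} (p q a : R) (n : nat).
Implicit Types (i j : 'I_n) (x : vpair n) (s : labels n) (o : option bool).
Implicit Types (G H : observation n).

Definition obs_pmf (r : R) o : R :=
  if o is Some b then a * bernoulli_pmf r b else 1 - a.

Definition obs_law s x : option bool -> R :=
  obs_pmf (if same_label s x then p else q).

(** Log-likelihood ratio of a pair across the communities against a pair within one. *)
Definition llr o : R :=
  match o with
  | Some true => ln (q / p)
  | Some false => ln ((1 - q) / (1 - p))
  | None => 0
  end.

Definition flip_llr s i x o : R :=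
  if incident i x then (if same_label s x then llr o else - llr o) else 0.

(** The exponent is the logarithm of L_i, so this is min(1, L_i). *)
Definition flip_score s i (G : observation n) : R :=
  Num.min 1 (expR (\sum_x flip_llr s i x (G x))).

Definition total_score s G : R := \sum_i flip_score s i G.

Lemma big_option_bool (F : option bool -> R) :
  \sum_o F o = F None + (F (Some true) + F (Some false)).
Proof.
rewrite (bigD1 None)//= (bigD1 (Some true))//= (bigD1 (Some false))//=.
by rewrite big1 ?addr0// => -[[]|].
Qed.

Lemma obs_pmf_sum1 r : \sum_o obs_pmf r o = 1.
Proof. by rewrite big_option_bool /=; ring. Qed.

Lemma obs_law_sum1 s x : \sum_o obs_law s x o = 1.
Proof. exact: obs_pmf_sum1. Qed.

Lemma uniform_labels : 2^-1 ^+ n * (\sum_(s : labels n) 1) = 1 :> R.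
Proof.
rewrite sumr_const card_ffun card_bool card_ord natrX.
by rewrite -exprMn mulVf ?expr1n// pnatr_eq0.
Qed.

(** Conditioning on the uniform labels makes the statuses of the pairs independent, so the later
    estimates can be carried out for fixed labels. *)
Lemma recovery_probE (f : estimator R n) :
  recovery_prob p q a f =
  \sum_s 2^-1 ^+ n * expect (obs_law s) (fun G => est_kernel f G s).
Proof.
have lawE s x o : obs_law s x o = \sum_b \sum_c
    if (if c then Some b else None) == o then
      bernoulli_pmf (if same_label s x then p else q) b * bernoulli_pmf a c
    else 0.
  by rewrite !big_bool /=; case: o => [[]|] /=; ring.
transitivity (\sum_s \sum_e \sum_r
    csbm_pmf p q a (s, e, r) * est_kernel f (censored_graph (s, e, r)) s).
  by rewrite pair_bigA pair_bigA; apply: eq_bigr => -[[s e] r].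
apply: eq_bigr => s _.
rewrite (eq_expect_law (lawE s)) -expect_pushforward2 mulr_sumr.
apply: eq_bigr => e _; rewrite mulr_sumr; apply: eq_bigr => r _.
rewrite /csbm_pmf -!mulrA; congr (_ * _).
rewrite (eq_bigr (fun=> 2^-1)) => [|i _].
  by rewrite prodr_const card_ord.
by rewrite /bernoulli_pmf; case: (s i) => //; field.
Qed.

Context (hp : 0 < p < 1) (hq : 0 < q < 1) (ha : 0 <= a < 1).

Let p0 : 0 < p. Proof. by case/andP: hp. Qed.
Let q0 : 0 < q. Proof. by case/andP: hq. Qed.
Let p1 : 0 < 1 - p. Proof. by case/andP: hp; rewrite subr_gt0. Qed.
Let q1 : 0 < 1 - q. Proof. by case/andP: hq; rewrite subr_gt0. Qed.
Let a0 : 0 <= a. Proof. by case/andP: ha. Qed.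
Let a1 : 0 < 1 - a. Proof. by case/andP: ha; rewrite subr_gt0. Qed.

Lemma obs_law_ge0 s x o : 0 <= obs_law s x o.
Proof.
rewrite /obs_law /obs_pmf /bernoulli_pmf.
case: o => [[]|]; last exact: ltW.
  by case: (same_label s x); apply: mulr_ge0 => //; exact: ltW.
by case: (same_label s x); apply: mulr_ge0 => //; exact: ltW.
Qed.

Lemma obs_pmf_llr o : obs_pmf p o * expR (llr o) = obs_pmf q o.
Proof.
case: o => [[]|] /=; rewrite ?expR0 ?mulr1// lnK ?posrE ?divr_gt0//.
  by rewrite /bernoulli_pmf; field; rewrite gt_eqF.
by rewrite /bernoulli_pmf; field; rewrite gt_eqF.
Qed.

Lemma obs_law_flip s i x o :
  obs_law (flip i s) x o = obs_law s x o * expR (flip_llr s i x o).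
Proof.
rewrite /obs_law same_label_flip /flip_llr.
case: (incident i x); last by rewrite expR0 mulr1.
case: (same_label s x) => /=; first by rewrite obs_pmf_llr.
by rewrite -obs_pmf_llr -mulrA -expRD subrr expR0 mulr1.
Qed.

Lemma prod_mass_flip s i G :
  prod_mass (obs_law s) G * expR (\sum_x flip_llr s i x (G x)) =
  prod_mass (obs_law (flip i s)) G.
Proof.
rewrite expR_sum -big_split; apply: eq_bigr => x _ /=.
by rewrite obs_law_flip.
Qed.

Lemma flip_score_ge0 s i G : 0 <= flip_score s i G.
Proof. by rewrite le_min ler01 expR_ge0. Qed.

Lemma flip_score_le1 s i G : flip_score s i G <= 1.
Proof. by rewrite ge_min lexx. Qed.

(* The estimator outputs at most one label vector, hence at most one of the
   single-vertex flips of the true labels. *)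
Lemma expect_estimator_total_score (f : estimator R n) :
  \sum_s 2^-1 ^+ n *
    expect (obs_law s) (fun G => est_kernel f G s * total_score s G) <= 1.
Proof.
rewrite -mulr_sumr -[leRHS]uniform_labels ler_wpM2l ?exprn_ge0 ?invr_ge0//.
apply: (@le_trans _ _ (\sum_s \sum_i \sum_G
    prod_mass (obs_law (flip i s)) G * est_kernel f G s)).
  apply: ler_sum => s _; rewrite [leRHS]exchange_big; apply: ler_sum => G _ /=.
  rewrite /total_score !mulr_sumr; apply: ler_sum => i _.
  rewrite -prod_mass_flip mulrCA [leRHS]mulrC ler_wpM2l ?est_kernel_ge0//.
  rewrite ler_wpM2l ?prod_mass_ge0 ?ge_min ?lexx ?orbT// => *.
  exact: obs_law_ge0.
rewrite exchange_big.
(* As flipping is an involution, it can be moved from the law to the target: under the single law of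
   [s], the kernel is now summed over the distinct flips of [s]. *)
under eq_bigr => i _ do rewrite (reindex_inj (inv_inj (flipK i))).
rewrite exchange_big; apply: ler_sum => s _ /=; rewrite exchange_big /=.
rewrite -(prod_mass_sum1 (obs_law s) (obs_law_sum1 s)); apply: ler_sum => G _.
under eq_bigr do rewrite flipK; rewrite -mulr_sumr ler_piMr//.
  by apply: prod_mass_ge0 => *; exact: obs_law_ge0.
rewrite -(est_kernel_sum1 f G).
rewrite -(big_imset (est_kernel f G)) => [|i j _ _ /flip_inj]//=.
rewrite [leRHS](bigID (mem [set flip i s | i in predT]%SET)) /= lerDl.
by apply: sumr_ge0 => *; exact: est_kernel_ge0.
Qed.

(** * Second moment of the total score *)

Context (B : R) (hB : forall o, `|llr o| <= B).

Let B0 : 0 <= B. Proof. exact: le_trans (normr_ge0 _) (hB None). Qed.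

Definition rest_score x0 s i (G : observation n) : R :=
  Num.min 1 (expR (\sum_(x | x != x0) flip_llr s i x (G x))).

Lemma rest_score_ge0 x0 s i G : 0 <= rest_score x0 s i G.
Proof. by rewrite le_min ler01 expR_ge0. Qed.

Lemma flip_score_None x0 s i G :
  G x0 = None -> flip_score s i G = rest_score x0 s i G.
Proof.
move=> Gx0; rewrite /flip_score (bigD1 x0)//= Gx0.
rewrite {1}/flip_llr /= oppr0 !if_same.
by rewrite add0r.
Qed.

(** A revealed pair shifts log L_i by at most [B]. Since [0 <= B], the factor exp B can be pulled
    out of the minimum with 1; a censored pair shifts nothing. *)
Lemma flip_score_le x0 s i G :
  flip_score s i G <= (if G x0 then expR B else 1) * rest_score x0 s i G.
Proof.
case Gx0 : (G x0) => [b|]; last by rewrite mul1r (flip_score_None _ _ _ _ Gx0).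
rewrite /flip_score /rest_score (bigD1 x0)//=.
have : flip_llr s i x0 (G x0) <= B.
  rewrite /flip_llr; case: ifP => _ //; case: ifP => _.
    exact: le_trans (ler_norm _) (hB _).
  by rewrite (le_trans (ler_norm _))// normrN.
move: (flip_llr _ _ _ _) (\sum_(_ | _) _) => y Y yB.
rewrite minr_pMr ?expR_ge0// mulr1 -expRD le_min !ge_min.
by rewrite !ler_expR lerD2r yB orbT andbT -expR0 ler_expR B0.
Qed.

Lemma expect_rest_score x0 s i (f : option bool -> R) :
  expect (obs_law s) (fun G => f (G x0) * rest_score x0 s i G) =
  (\sum_o obs_law s x0 o * f o) * expect (obs_law s) (rest_score x0 s i).
Proof.
rewrite (expectM _ (pred1 x0) (fun G => f (G x0)))//.
- by rewrite (expect_coord _ _ f)//; exact: obs_law_sum1.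
- exact: obs_law_sum1.
- by move=> G H /(_ x0) -> /=.
- move=> G H GH; rewrite /rest_score; congr (Num.min _ (expR _)).
  by apply: eq_bigr => x xx0; rewrite GH.
Qed.

(** Independence is used twice: first to split off [x0], then to separate the other pairs at [i]
    from those at [j]. *)
Lemma expect_rest_scoreM x0 s i j (f : option bool -> R) :
  (forall x, incident i x -> incident j x -> x = x0) ->
  expect (obs_law s)
    (fun G => f (G x0) * (rest_score x0 s i G * rest_score x0 s j G)) =
  (\sum_o obs_law s x0 o * f o) *
  (expect (obs_law s) (rest_score x0 s i) *
   expect (obs_law s) (rest_score x0 s j)).
Proof.
move=> common.
have dep k G H : (forall x, x != x0 -> incident k x -> G x = H x) ->
    rest_score x0 s k G = rest_score x0 s k H.
  move=> GH; rewrite /rest_score; congr (Num.min _ (expR _)).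
  apply: eq_bigr => x xx0; rewrite /flip_llr; case: ifP => // kx.
  by rewrite GH.
rewrite (expectM _ (pred1 x0) (fun G => f (G x0))); first last.
- by move=> G H GH; congr (_ * _); apply: dep => x xx0 _; rewrite GH.
- by move=> G H /(_ x0) -> /=.
- exact: obs_law_sum1.
congr (_ * _); first by rewrite (expect_coord _ _ f)//; exact: obs_law_sum1.
apply: (expectM _ (fun x => incident i x && (x != x0))).
- exact: obs_law_sum1.
- by move=> G H GH; apply: dep => x xx0 ix; rewrite GH// ix.
- move=> G H GH; apply: dep => x xx0 jx; rewrite GH//=.
  by apply: contra xx0 => /andP[ix _]; apply/eqP/common.
Qed.

(** Keeps only the event that [x0] is censored: it has probability [1 - a], is independent of the
    remaining score, and makes the two scores equal. *)
Lemma expect_flip_score_rest x0 s i :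
  (1 - a) * expect (obs_law s) (rest_score x0 s i) <=
  expect (obs_law s) (flip_score s i).
Proof.
have := expect_rest_score x0 s i (fun o => if o then 0 else 1).
rewrite big_option_bool /= !mulr0 !addr0 mulr1 => <-.
apply: le_expect => [|G]; first exact: obs_law_ge0.
case Gx0 : (G x0) => [b|]; first by rewrite mul0r flip_score_ge0.
by rewrite mul1r (flip_score_None _ _ _ _ Gx0).
Qed.

(* Two scores share only the observation of one pair, which is revealed with
   probability a and changes each score by a factor at most exp B. *)
Lemma expect_flip_scoreM s i j : i != j ->
  (1 - a) ^+ 2 *
    expect (obs_law s) (fun G => flip_score s i G * flip_score s j G) <=
  (1 + a * expR B ^+ 2) *
    (expect (obs_law s) (flip_score s i) * expect (obs_law s) (flip_score s j)).
Proof.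
move=> /common_pair[x0 common].
have lawge0 := obs_law_ge0 s.
pose f (o : option bool) : R := if o then expR B ^+ 2 else 1.
set Ei := expect _ (flip_score s i); set Ej := expect _ (flip_score s j).
pose Ri := expect (obs_law s) (rest_score x0 s i).
pose Rj := expect (obs_law s) (rest_score x0 s j).
have Ri0 : 0 <= Ri by apply: expect_ge0 => // G; exact: rest_score_ge0.
have Rj0 : 0 <= Rj by apply: expect_ge0 => // G; exact: rest_score_ge0.
have le1 : expect (obs_law s) (fun G => flip_score s i G * flip_score s j G) <=
    (1 + a * expR B ^+ 2) * (Ri * Rj).
  apply: le_trans (_ : (\sum_o obs_law s x0 o * f o) * (Ri * Rj) <= _).
    rewrite -expect_rest_scoreM//; apply: le_expect => // G.
    apply: le_trans (ler_pM _ _ (flip_score_le x0 s i G)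
      (flip_score_le x0 s j G)) _; rewrite ?flip_score_ge0//.
    rewrite mulrACA ler_wpM2r ?mulr_ge0 ?rest_score_ge0// /f.
    by case: (G x0) => //=; rewrite mulr1.
  rewrite ler_wpM2r ?mulr_ge0// big_option_bool /= /f /bernoulli_pmf.
  have coef (r e : R) :
      (1 - a) * 1 + (a * r * e + a * (1 - r) * e) <= 1 + a * e.
    by rewrite [leLHS](_ : _ = 1 - a + a * e); [rewrite lerD2r gerBl|ring].
  by case: ifP => _; exact: coef.
have li : (1 - a) * Ri <= Ei := expect_flip_score_rest x0 s i.
have lj : (1 - a) * Rj <= Ej := expect_flip_score_rest x0 s j.
apply: le_trans (ler_wpM2l _ le1) _; first exact: sqr_ge0.
rewrite mulrCA ler_wpM2l ?addr_ge0 ?mulr_ge0 ?sqr_ge0//.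
by rewrite expr2 mulrACA ler_pM ?mulr_ge0// ltW.
Qed.

Definition mean_score s : R := \sum_i expect (obs_law s) (flip_score s i).

Lemma expect_total_score s : expect (obs_law s) (total_score s) = mean_score s.
Proof. exact: expect_sum. Qed.

Lemma expect_total_score_sqr s :
  (1 - a) ^+ 2 * expect (obs_law s) (fun G => total_score s G ^+ 2) <=
  (1 - a) ^+ 2 * mean_score s + (1 + a * expR B ^+ 2) * mean_score s ^+ 2.
Proof.
have lawge0 := obs_law_ge0 s.
have E0 i : 0 <= expect (obs_law s) (flip_score s i).
  by apply: expect_ge0 => // G; exact: flip_score_ge0.
rewrite (eq_expect _ _
  (fun G => \sum_i \sum_j flip_score s i G * flip_score s j G)); last first.
  by move=> G; rewrite expr2 big_distrlr.
rewrite expect_sum; under eq_bigr do rewrite expect_sum.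
apply: ler_second_moment => //.
- exact: sqr_ge0.
- by rewrite addr_ge0 ?mulr_ge0 ?sqr_ge0.
- move=> i; apply: le_expect => // G.
  by rewrite ler_piMr ?flip_score_ge0 ?flip_score_le1.
- exact: expect_flip_scoreM.
Qed.

(** Dividing the second moment of the total score by its squared mean gives at most 1 + [excess_var]
    plus the inverse of the mean. *)
Definition excess_var : R := (1 + a * expR B ^+ 2) / (1 - a) ^+ 2 - 1.

Lemma excess_var_ge0 : 0 <= excess_var.
Proof.
rewrite subr_ge0 ler_pdivlMr ?exprn_gt0// mul1r.
apply: (@le_trans _ _ 1); last by rewrite lerDl mulr_ge0// sqr_ge0.
by rewrite exprn_ile1 ?(ltW a1)// gerBl.
Qed.

(** * From concentration of the score to a bound on the success probability *)

Lemma est_kernel_le1 (f : estimator R n) G s : est_kernel f G s <= 1.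
Proof.
rewrite -(est_kernel_sum1 f G) (bigD1 s)//= lerDl.
by apply: sumr_ge0 => *; exact: est_kernel_ge0.
Qed.

(** With u = S / mu and k the kernel value, k <= k u + eta + (1 - u)^2 / (4 eta) pointwise. Averaged
    over labels, the first term is small by [expect_estimator_total_score]; the last is the relative
    variance of S, as in Chebyshev's inequality. *)
Lemma expect_estimator_le (f : estimator R n) s (M eta : R) :
  0 < M -> M <= mean_score s -> 0 < eta ->
  expect (obs_law s) (fun G => est_kernel f G s) <=
  M^-1 * expect (obs_law s) (fun G => est_kernel f G s * total_score s G) +
  (eta + (M^-1 + excess_var) / (4 * eta)).
Proof.
move=> M0 Mmu eta0; have lawge0 := obs_law_ge0 s.
set mu := mean_score s in Mmu; have mu0 : 0 < mu by exact: lt_le_trans Mmu.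
pose S := total_score s.
have S0 G : 0 <= S G by apply: sumr_ge0 => i _; exact: flip_score_ge0.
have muM : mu^-1 <= M^-1 by rewrite lef_pV2.
have ES2 : expect (obs_law s) (fun G => S G ^+ 2) / mu ^+ 2 <=
    mu^-1 + (excess_var + 1).
  rewrite ler_pdivrMr ?exprn_gt0// mulrDl expr2 mulKf ?gt_eqF//.
  rewrite /excess_var subrK -(ler_pM2l (exprn_gt0 2 a1)) mulrDr.
  apply: le_trans (expect_total_score_sqr s) _.
  rewrite lerD2l [leRHS]mulrA [(1 - a) ^+ 2 * _]mulrC divfK//.
  by rewrite gt_eqF// exprn_gt0.
apply: (@le_trans _ _ (mu^-1 * expect (obs_law s)
    (fun G => est_kernel f G s * S G) +
  (eta + (4 * eta)^-1 * expect (obs_law s) (fun G => (1 - S G / mu) ^+ 2)))).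
  rewrite -[X in _ + (X + _)](expect_cst _ eta (obs_law_sum1 s)).
  rewrite -!expectZ -!expectD; apply: le_expect => // G.
  have k0 := est_kernel_ge0 f G s; have k1 := est_kernel_le1 f G s.
  set k := est_kernel _ _ _ in k0 k1 *.
  rewrite [mu^-1 * _]mulrC -mulrA; set u := S G / mu.
  have am : 1 - u <= eta + (4 * eta)^-1 * (1 - u) ^+ 2.
    rewrite -(ler_pM2l (_ : 0 < 4 * eta)) ?mulr_gt0// [leRHS]mulrDr.
    rewrite mulVKf ?gt_eqF ?mulr_gt0//.
    by have := sqr_ge0 (1 - u - 2 * eta); lra.
  have r0 : 0 <= eta + (4 * eta)^-1 * (1 - u) ^+ 2.
    apply: addr_ge0; first exact: ltW.
    by rewrite mulr_ge0 ?sqr_ge0// invr_ge0 mulr_ge0// ltW.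
  set r := eta + _ in am r0 *.
  (* If u <= 1, then k (1 - u) <= 1 - u <= r because k <= 1; otherwise k (1 - u) is at most 0. *)
  have [u1|u1] := lerP u 1; nra.
apply: lerD.
  rewrite ler_wpM2r//; apply: expect_ge0 => // G.
  by rewrite mulr_ge0 ?est_kernel_ge0.
rewrite lerD2l mulrC; apply: ler_wpM2r.
  by rewrite invr_ge0 mulr_ge0// ltW.
rewrite (eq_expect _ _
  (fun G => (1 + (- (2 / mu)) * S G) + (mu ^+ 2)^-1 * S G ^+ 2)); last first.
  by move=> G; field; rewrite gt_eqF.
rewrite !expectD !expectZ expect_cst; last exact: obs_law_sum1.
rewrite expect_total_score -/mu mulNr mulfVK ?gt_eqF// [_^-1 * _]mulrC.
apply: le_trans (_ : 1 - 2 + (mu^-1 + (excess_var + 1)) <= _).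
  by rewrite lerD2l.
by lra.
Qed.

(** * Hellinger affinity of the Bernoulli laws and lower bound for the mean score *)

Definition affinity : R := Num.sqrt (p * q) + Num.sqrt ((1 - p) * (1 - q)).

(* The unnormalised geometric mean of the laws of one observation within and
   across the communities. *)
Definition geo_mean o : R :=
  match o with
  | Some true => a * Num.sqrt (p * q)
  | Some false => a * Num.sqrt ((1 - p) * (1 - q))
  | None => 1 - a
  end.

Definition geo_mass : R := 1 - a * (1 - affinity).

(** Under the normalised geometric mean, a pair is revealed with probability
    [tilted_rate * affinity]. *)
Definition tilted_rate : R := a / geo_mass.

Lemma affinity_gt0 : 0 < affinity.
Proof. by rewrite addr_gt0 ?sqrtr_gt0 ?mulr_gt0. Qed.

Lemma affinity_le1 : affinity <= 1.
Proof.
have amgm (u v : R) : 0 < u -> 0 < v -> Num.sqrt (u * v) <= (u + v) / 2.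
  move=> u0 v0; rewrite -[leRHS]ger0_norm; last first.
    by rewrite mulr_ge0 ?addr_ge0 ?(ltW u0) ?(ltW v0) ?invr_ge0.
  rewrite -sqrtr_sqr ler_wsqrtr// -subr_ge0.
  by rewrite [leRHS](_ : _ = ((u - v) / 2) ^+ 2) ?sqr_ge0//; field.
apply: le_trans (lerD (amgm p q p0 q0) (amgm (1 - p) (1 - q) p1 q1)) _.
by rewrite [leLHS](_ : _ = 1)//; field.
Qed.

Lemma geo_mass_gt0 : 0 < geo_mass.
Proof.
rewrite /geo_mass [ltRHS](_ : _ = (1 - a) + a * affinity); last by ring.
by rewrite ltr_pwDl// mulr_ge0// ltW// affinity_gt0.
Qed.

Lemma geo_mass_le1 : geo_mass <= 1.
Proof. by rewrite /geo_mass gerBl mulr_ge0// subr_ge0 affinity_le1. Qed.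

Lemma tilted_rate_ge0 : 0 <= tilted_rate.
Proof. by rewrite divr_ge0// ltW// geo_mass_gt0. Qed.

Lemma geo_mean_ge0 o : 0 <= geo_mean o.
Proof.
by case: o => [[]|] /=; rewrite ?mulr_ge0 ?sqrtr_ge0//; exact: ltW.
Qed.

Lemma geo_mean_sum : \sum_o geo_mean o = geo_mass.
Proof. by rewrite big_option_bool /= /geo_mass /affinity; ring. Qed.

Lemma mulr_expR_half_ln (u v : R) : 0 < u -> 0 < v ->
  u * expR (ln (v / u) / 2) = Num.sqrt (u * v).
Proof.
move=> u0 v0; rewrite -[LHS]ger0_norm ?mulr_ge0 ?expR_ge0 ?(ltW u0)//.
rewrite -sqrtr_sqr; congr Num.sqrt.
rewrite exprMn -expRM_natr divfK ?pnatr_eq0// lnK ?posrE ?divr_gt0//.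
by field; rewrite gt_eqF.
Qed.

Lemma obs_pmf_geo_mean o : obs_pmf p o * expR (llr o / 2) = geo_mean o.
Proof.
case: o => [[]|] /=; rewrite /bernoulli_pmf; last by rewrite mul0r expR0 mulr1.
  by rewrite -mulrA mulr_expR_half_ln.
by rewrite -mulrA mulr_expR_half_ln.
Qed.

Lemma obs_law_geo_mean s i x o : incident i x ->
  obs_law s x o * expR (flip_llr s i x o / 2) = geo_mean o.
Proof.
move=> ix; rewrite /obs_law /flip_llr ix -obs_pmf_geo_mean.
case: (same_label s x) => //; rewrite -obs_pmf_llr -mulrA -expRD.
by congr (_ * expR _); lra.
Qed.

Definition spin (b : bool) : R := if b then 1 else -1.

Definition magnetization s : R := \sum_i spin (s i).

Lemma sum_geo_mean_le (f : option bool -> R) (c : R) :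
  f None = 0 -> (forall o, `|f o| <= c) ->
  `|\sum_o geo_mean o / geo_mass * f o| <= tilted_rate * c.
Proof.
move=> f0 fc; have c0 : 0 <= c by exact: le_trans (normr_ge0 _) (fc None).
have wsqrt (u : R) : 0 <= tilted_rate * Num.sqrt u.
  by rewrite mulr_ge0 ?sqrtr_ge0 ?tilted_rate_ge0.
rewrite big_option_bool f0 mulr0 add0r /= ![a * _ / _]mulrAC -/tilted_rate.
have term (u : R) o : `|tilted_rate * Num.sqrt u * f o| <=
    tilted_rate * Num.sqrt u * c.
  by rewrite normrM (ger0_norm (wsqrt u)) ler_wpM2l.
apply: le_trans (ler_normD _ _) _.
apply: le_trans (lerD (term _ _) (term _ _)) _.
rewrite -mulrDl -mulrDr ler_wpM2r// ler_piMr ?tilted_rate_ge0//.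
exact: affinity_le1.
Qed.

(** The sign of a pair is the product of its two spins; the [- 1] removes the diagonal term [j = i].
    This sum governs the tilted mean of log L_i. *)
Lemma sum_incident_spin s i :
  \sum_(x : vpair n | incident i x) (if same_label s x then 1 else -1) =
  spin (s i) * magnetization s - 1.
Proof.
transitivity (\sum_(j | j != i) spin (s i) * spin (s j)).
  rewrite -(big_incident _ _ _ i (fun j k => spin (s j) * spin (s k))).
    apply: eq_bigr => x _; rewrite /same_label /spin.
    by case: (s _); case: (s _); rewrite /= ?mulr1 ?mul1r ?mulrNN ?mulr1.
  by move=> j k; rewrite mulrC.
rewrite -mulr_sumr /magnetization [in RHS](bigD1 i)//= mulrDr.
rewrite [spin (s i) * spin (s i)](_ : _ = 1) ?[1 + _]addrC ?addrK//.
by rewrite /spin; case: (s i); rewrite ?mulrNN mulr1.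
Qed.

(** Bounds the second moment of log L_i under the tilted law: a variance part, then the squared
    mean, where (±D - 1)^2 <= 2 D^2 + 2 for the magnetization D. *)
Definition tilted_moment s : R := n%:R * (tilted_rate * B ^+ 2) +
  (tilted_rate * B) ^+ 2 * (2 * magnetization s ^+ 2 + 2).

(** Only the pairs at [i] are tilted; the others keep their law and have normalisation 1. *)
Lemma expect_flip_score_ge s i (c : R) : 0 < c ->
  geo_mass ^+ n * expR (- (c / 4 + tilted_moment s / (4 * c))) <=
  expect (obs_law s) (flip_score s i).
Proof.
move=> c0; have z0 := geo_mass_gt0.
pose z x := if incident i x then geo_mass else 1.
pose law x o := if incident i x then geo_mean o / geo_mass else obs_law s x o.
have law0 x o : 0 <= law x o.
  rewrite /law; case: (incident i x); last exact: obs_law_ge0.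
  by rewrite divr_ge0 ?geo_mean_ge0 ?(ltW z0).
have law1 x : \sum_o law x o = 1.
  rewrite /law; case: (incident i x); last exact: obs_law_sum1.
  by rewrite -mulr_suml geo_mean_sum divff// gt_eqF.
have card_incident (V : Type) (idx : V) (op : Monoid.com_law idx) (v : V) :
    \big[op/idx]_(x : vpair n | incident i x) v = iterop n.-1 op v idx.
  rewrite (big_incident _ idx op i (fun _ _ => v))// big_const cardC1 card_ord.
  by rewrite Monoid.iteropE.
apply: le_trans (expect_min_expR_ge (obs_law s) (flip_llr s i) z law c c0
  law0 law1 _ _ _); first last.
- exact: obs_law_ge0.
- by move=> x; rewrite /z; case: ifP => _ //; exact: ltW.
- move=> x o; rewrite /z /law; case: ifP => ix.
    by rewrite obs_law_geo_mean// [RHS]mulrC divfK ?gt_eqF.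
  by rewrite /flip_llr ix mul0r expR0 mulr1 mul1r.
have -> : \prod_x z x = geo_mass ^+ n.-1.
  by rewrite /z -big_mkcond card_incident.
apply: ler_pM; rewrite ?exprn_ge0 ?expR_ge0 ?(ltW z0)//.
  (* Only [n.-1] pairs meet [i]; the power is raised to [n] since [geo_mass] is at most 1. *)
  by apply: ler_wiXn2l; rewrite ?(ltW z0) ?geo_mass_le1 ?leq_pred.
rewrite ler_expR lerN2 lerD2l ler_wpM2r ?invr_ge0 ?mulr_ge0 ?(ltW c0)//.
apply: le_trans (second_moment_sum _ (flip_llr s i) law0 law1) _.
apply: lerD.
  apply: (@le_trans _ _ (\sum_(x | incident i x) tilted_rate * B ^+ 2)).
    rewrite [leRHS]big_mkcond; apply: ler_sum => x _; rewrite /law /flip_llr.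
    case: (incident i x); last by rewrite big1// => o _; rewrite expr0n mulr0.
    have llr2 : \sum_o geo_mean o / geo_mass * llr o ^+ 2 <=
        tilted_rate * B ^+ 2.
      apply: le_trans (ler_norm _) (sum_geo_mean_le
        (fun o => llr o ^+ 2) _ _ _).
        by rewrite expr0n.
      by move=> o; rewrite normrX lerXn2r ?nnegrE.
    by case: (same_label s x) => //; under eq_bigr do rewrite sqrrN.
  rewrite card_incident Monoid.iteropE iter_addr_0 [leRHS]mulr_natl.
  by rewrite ler_wpMn2l ?leq_pred// mulr_ge0 ?tilted_rate_ge0 ?sqr_ge0.
(* The tilted law is the same for both kinds of pairs, but the log-likelihood ratio changes sign:
   their means are [m] and [- m], and nearly cancel for balanced labels. *)
pose m := \sum_o geo_mean o / geo_mass * llr o.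
have -> : \sum_x \sum_o law x o * flip_llr s i x o =
    (spin (s i) * magnetization s - 1) * m.
  rewrite -sum_incident_spin mulr_suml [RHS]big_mkcond; apply: eq_bigr => x _.
  rewrite /law /flip_llr.
  case: (incident i x); last by rewrite big1// => o _; rewrite mulr0.
  case: (same_label s x); first by rewrite mul1r.
  by rewrite mulN1r -sumrN; apply: eq_bigr => o _; rewrite mulrN.
rewrite exprMn mulrC; apply: ler_pM; rewrite ?sqr_ge0//.
  rewrite -real_normK ?num_real// lerXn2r ?nnegrE ?sum_geo_mean_le//.
  by rewrite mulr_ge0// tilted_rate_ge0.
rewrite /spin; move: (magnetization s) => D.
have := sqr_ge0 (D - 1); have := sqr_ge0 (D + 1).
by case: (s i); nra.
Qed.

(** * Averaging over the uniform labels *)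

Lemma magnetization_second_moment :
  \sum_s 2^-1 ^+ n * magnetization s ^+ 2 <= n%:R.
Proof.
pose coin (_ : 'I_n) (_ : bool) : R := 2^-1.
have coin1 i : \sum_b coin i b = 1 by rewrite big_bool /= /coin; field.
have coin0 i b : 0 <= coin i b by rewrite /coin invr_ge0.
have := second_moment_sum coin (fun=> spin) coin0 coin1.
rewrite (eq_bigr (fun=> 1)) => [|i _]; last first.
  by rewrite big_bool /= /coin /spin; field.
rewrite [X in X ^+ 2]big1 => [|i _]; last first.
  by rewrite big_bool /= /coin /spin; field.
rewrite expr0n addr0 sumr_const card_ord; apply: le_trans.
by apply: ler_sum => s _; rewrite /prod_mass prodr_const card_ord.
Qed.

(* Labellings with an unbalanced community are absorbed by the first term. *)
Lemma recovery_prob_le (f : estimator R n) (c d M eta : R) :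
  0 < c -> 0 < d -> 0 < eta -> 0 < M ->
  M <= n%:R * (geo_mass ^+ n * expR (- (c / 4 +
    (n%:R * (tilted_rate * B ^+ 2) +
      (tilted_rate * B) ^+ 2 * (2 * d + 2)) / (4 * c)))) ->
  recovery_prob p q a f <=
  n%:R / d + (M^-1 + (eta + (M^-1 + excess_var) / (4 * eta))).
Proof.
move=> c0 d0 eta0 M0 hM; rewrite recovery_probE.
set r := eta + _.
have half0 : 0 <= 2^-1 ^+ n :> R by rewrite exprn_ge0 ?invr_ge0.
have M10 : 0 <= M^-1 by rewrite invr_ge0 ltW.
have r0 : 0 <= r.
  rewrite addr_ge0 ?(ltW eta0)// divr_ge0 ?mulr_ge0 ?(ltW eta0)//.
  by rewrite addr_ge0 ?excess_var_ge0.
pose kS s := expect (obs_law s) (fun G => est_kernel f G s * total_score s G).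
have kS0 s : 0 <= kS s.
  apply: expect_ge0 => [|G]; first exact: obs_law_ge0.
  rewrite mulr_ge0 ?est_kernel_ge0//; apply: sumr_ge0 => i _.
  exact: flip_score_ge0.
apply: (@le_trans _ _ (\sum_s
    2^-1 ^+ n * (magnetization s ^+ 2 / d + (M^-1 * kS s + r)))).
  apply: ler_sum => s _; rewrite ler_wpM2l//.
  have [balanced|unbalanced] := lerP (magnetization s ^+ 2) d.
    rewrite ler_wpDl ?divr_ge0 ?sqr_ge0 ?(ltW d0)//.
    apply: expect_estimator_le => //; apply: le_trans hM _.
    rewrite mulr_natl -[X in _ *+ X](card_ord n) -sumr_const.
    apply: ler_sum => i _; apply: le_trans (expect_flip_score_ge s i c c0).
    rewrite ler_wpM2l ?exprn_ge0 ?(ltW geo_mass_gt0)//.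
    rewrite ler_expR lerN2 lerD2l ler_wpM2r ?invr_ge0 ?mulr_ge0 ?(ltW c0)//.
    by rewrite lerD2l ler_wpM2l ?sqr_ge0// lerD2r ler_wpM2l.
  apply: ler_wpDr; first exact: addr_ge0 (mulr_ge0 M10 (kS0 s)) r0.
  apply: (@le_trans _ _ 1); last by rewrite ler_pdivlMr// mul1r ltW.
  rewrite -[leRHS](expect_cst (obs_law s) 1 (obs_law_sum1 s)).
  apply: le_expect => [|G]; first exact: obs_law_ge0.
  exact: est_kernel_le1.
move: r {r0} => r; under eq_bigr do rewrite !mulrDr.
rewrite !big_split /=; apply: lerD.
  under eq_bigr do rewrite mulrA.
  rewrite -mulr_suml ler_wpM2r ?invr_ge0 ?(ltW d0)//.
  exact: magnetization_second_moment.
apply: lerD.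
  under eq_bigr do rewrite mulrCA.
  by rewrite -mulr_sumr ler_piMr// expect_estimator_total_score.
rewrite -[leRHS]mul1r -[X in _ <= X * _]uniform_labels -mulrA mulr_suml.
by rewrite mulr_sumr; under [leRHS]eq_bigr do rewrite mul1r.
Qed.

End CensoredModel.

(** * Asymptotic estimates in n *)

Lemma expR_exponent_le {R : realType} (n : nat) (L t H B theta a z : R) :
  n%:R = expR L -> 0 < L -> 0 < t -> 0 < B -> 0 < theta -> 0 <= H ->
  4 * theta = 1 - t * H -> a = t * L / n%:R -> z = 1 - a * H -> 2^-1 <= z ->
  a * H * (t * H + theta) <= theta -> 1 <= (theta / (t * B) * n%:R) ^+ 2 ->
  expR (theta * L - t * B ^+ 2 / (8 * theta)) <=
  n%:R * (z ^+ n * expR (- (4 * theta * L / 4 +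
    (n%:R * (a / z * B ^+ 2) +
      (a / z * B) ^+ 2 * (2 * (theta / (t * B) * n%:R) ^+ 2 + 2)) /
    (4 * (4 * theta * L))))).
Proof.
move=> nL L0 t0 B0 theta0 H0 thetaE aE zE z2 aH d1.
have n0 : 0 < n%:R :> R by rewrite nL expR_gt0.
have z0 : 0 < z by apply: lt_le_trans z2; rewrite invr_gt0.
have a0 : 0 <= a by rewrite aE divr_ge0 ?mulr_ge0 ?(ltW t0) ?(ltW L0) ?(ltW n0).
have anE : a * n%:R = t * L by rewrite aE divfK ?gt_eqF.
pose r := a / z; have r0 : 0 <= r by rewrite divr_ge0 ?(ltW z0).
have zr : z * r = a by rewrite mulrC divfK ?gt_eqF.
rewrite -/r.
(* Since z = 1 - a H and r = a / z, one has 1 / z = 1 + r H <= exp(r H). *)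
have ez : expR (- (r * H)) <= z.
  rewrite expRN -[leRHS]invrK lef_pV2 ?posrE ?expR_gt0 ?invr_gt0//.
  apply: le_trans (expR_ge1Dx _); rewrite -(ler_pM2l z0) divff ?gt_eqF//.
  by rewrite mulrDr mulr1 mulrA zr zE subrK.
(* Replacing [a] by [a / z] costs one [theta * L]; hypothesis [aH] is exactly the condition for
   this. *)
have rnH : n%:R * (r * H) <= (t * H + theta) * L.
  rewrite -(ler_pM2l z0) (_ : z * _ = t * L * H); last first.
    by rewrite -anE -zr; ring.
  rewrite zE -subr_ge0 (_ : _ - _ = (theta - a * H * (t * H + theta)) * L).
    by rewrite mulr_ge0 ?subr_ge0 ?(ltW L0).
  by ring.
have rn : n%:R * r <= 2 * (t * L).
  rewrite -anE [n%:R * r]mulrC mulrA ler_wpM2r ?(ltW n0)// -zr mulrA.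
  rewrite ler_peMl// -(ler_pM2l (_ : 0 < 2^-1 :> R)) ?invr_gt0//.
  by rewrite mulr1 mulKf ?pnatr_eq0.
have pow : expR (- (n%:R * (r * H))) <= z ^+ n.
  by rewrite -mulrN expRM_natl lerXn2r ?nnegrE ?expR_ge0 ?(ltW z0).
pose w := theta / (t * B) * n%:R.
(* The threshold [w] is calibrated so that 2 r B w <= 4 theta L; after division by 16 theta L the
   magnetization part costs only [theta * L]. *)
have quad : (r * B) ^+ 2 * (2 * w ^+ 2 + 2) <= 16 * theta ^+ 2 * L ^+ 2.
  apply: (@le_trans _ _ ((r * B) ^+ 2 * (4 * w ^+ 2))).
    rewrite ler_wpM2l ?sqr_ge0// (_ : 4 * w ^+ 2 = 2 * w ^+ 2 + 2 * w ^+ 2).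
      by rewrite lerD2l -[leLHS]mulr1 ler_wpM2l.
    by ring.
  rewrite (_ : _ * _ = (2 * theta / t * (n%:R * r)) ^+ 2); last first.
    by rewrite /w; field; rewrite !gt_eqF.
  rewrite (_ : 16 * _ * _ = (2 * theta / t * (2 * (t * L))) ^+ 2); last first.
    by field; rewrite gt_eqF.
  rewrite lerXn2r ?nnegrE ?mulr_ge0 ?invr_ge0
    ?(ltW t0) ?(ltW theta0) ?(ltW L0) ?(ltW n0) ?(ltW z0)//.
  by rewrite ler_wpM2l// !mulr_ge0 ?invr_ge0 ?(ltW t0) ?(ltW theta0).
apply: le_trans (ler_wpM2l (ltW n0) (ler_wpM2r (expR_ge0 _) pow)).
rewrite [X in _ <= X * _]nL -!expRD ler_expR.
have frac : (n%:R * (r * B ^+ 2) + (r * B) ^+ 2 * (2 * w ^+ 2 + 2)) /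
    (4 * (4 * theta * L)) <= t * B ^+ 2 / (8 * theta) + theta * L.
  rewrite ler_pdivrMr; last by rewrite !mulr_gt0.
  apply: le_trans (lerD (_ : _ <= 2 * (t * L) * B ^+ 2) quad) _.
    by rewrite mulrA ler_wpM2r ?sqr_ge0.
  rewrite le_eqVlt; apply/orP; left; apply/eqP; field.
  by rewrite gt_eqF.
(* The slack 1 - t H = 4 theta is spent in three parts [theta]: on [z ^+ n], on [c / 4] with c = 4
   theta L, and on the magnetization. One [theta * L] remains, up to a constant from the
   variance. *)
have -> : theta * L - t * B ^+ 2 / (8 * theta) = L + (- ((t * H + theta) * L) +
   - (4 * theta * L / 4 + (t * B ^+ 2 / (8 * theta) + theta * L))).
  have -> : t * H = 1 - 4 * theta by rewrite thetaE; ring.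
  by field; rewrite gt_eqF.
by rewrite lerD2l lerD// lerN2// lerD2l.
Qed.

Lemma excess_var_le {R : realType} (a B : R) : 0 <= a <= 2^-1 ->
  excess_var a B <= a * (4 * (expR B ^+ 2 + 2)).
Proof.
case/andP=> a0 a2; rewrite /excess_var; move: (expR B ^+ 2) (sqr_ge0 (expR B)).
move=> E E0.
have a1 : 2^-1 <= 1 - a by lra.
have a3 : 0 < 1 - a by lra.
have a4 : 4^-1 <= (1 - a) ^+ 2.
  rewrite (_ : 4^-1 = (2^-1) ^+ 2); last by field.
  by rewrite lerXn2r ?nnegrE ?invr_ge0 ?(ltW a3).
rewrite lerBlDr ler_pdivrMr ?exprn_gt0// mulrDl mul1r.
apply: (@le_trans _ _ (a * (4 * (E + 2)) * 4^-1 + (1 - a) ^+ 2)); last first.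
  by rewrite lerD2r ler_wpM2l// !mulr_ge0// addr_ge0.
have := sqr_ge0 a; nra.
Qed.

Lemma near_ln_ge {R : realType} (A : R) :
  \forall n \near \oo, A <= ln n%:R.
Proof.
near=> n; have nA : expR A <= n%:R by near: n; exact: nbhs_infty_ger.
by rewrite -[A]expRK ler_ln ?posrE ?expR_gt0// (lt_le_trans (expR_gt0 _) nA).
Unshelve. all: by end_near. Qed.

(** With L = log n, n = exp L >= L^2 / 2, hence t L / n <= 2 t / L. *)
Lemma near_reveal_rate_le {R : realType} (t k : R) : 0 < t -> 0 < k ->
  \forall n \near \oo, reveal_rate t n <= k.
Proof.
move=> t0 k0; near=> n.
have L1 : 1 <= ln (n%:R : R) by near: n; exact: near_ln_ge.
have Lk : 2 * t / k <= ln (n%:R : R) by near: n; exact: near_ln_ge.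
have n0 : 0 < n%:R :> R by near: n; exact: nbhs_infty_gtr.
set L := ln _ in L1 Lk; have L0 : 0 <= L by exact: le_trans L1.
have nE : n%:R = expR L by rewrite lnK.
have := expR_ge1Dxn 1 L0; rewrite -nE => nL.
rewrite /reveal_rate -/L ler_pdivrMr//.
move: Lk; rewrite ler_pdivrMr// => Lk.
apply: (@le_trans _ _ (k * (L ^+ 2 / 2))).
  rewrite -(ler_pM2l (_ : 0 < 2 :> R))// (_ : 2 * (k * _) = L * k * L).
    by rewrite mulrA ler_wpM2r.
  by field.
by rewrite ler_wpM2l ?(ltW k0)//; apply: le_trans nL; rewrite lerDr.
Unshelve. all: by end_near. Qed.

(** Expanding the squares, p + q + (1 - q) + (1 - p) = 2 and the mixed terms form the affinity. *)
Lemma t_c_affinity {R : realType} (p q : R) : 0 < p < 1 -> 0 < q < 1 ->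
  t_c p q = 2 / (2 * (1 - affinity p q)).
Proof.
case/andP=> p0 p1 /andP[q0 q1]; rewrite /t_c; congr (_ / _).
rewrite /affinity sqrtrM ?(ltW p0)// sqrtrM ?subr_ge0 ?(ltW p1)//.
have sp := sqr_sqrtr (ltW p0); have sq := sqr_sqrtr (ltW q0).
have sp' : Num.sqrt (1 - p) ^+ 2 = 1 - p by rewrite sqr_sqrtr// subr_ge0 ltW.
have sq' : Num.sqrt (1 - q) ^+ 2 = 1 - q by rewrite sqr_sqrtr// subr_ge0 ltW.
rewrite !sqrrB sp sq sp' sq'; ring.
Qed.

Theorem theorem2p1 (R : realType) (p q t : R)
    (hp : 0 < p < 1) (hq : 0 < q < 1) (hpq : p != q)
    (ht : 0 < t) (htc : t < t_c p q)
    (sigma_hat : forall n : nat, estimator R n) :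
  (fun n : nat => recovery_prob p q (reveal_rate t n) (sigma_hat n))
    @ \oo --> (0 : R).
Proof.
pose H := 1 - affinity p q.
have H0 : 0 <= H by rewrite subr_ge0 affinity_le1.
have H1 : H <= 1 by rewrite gerBl ltW// affinity_gt0.
have tH : t * H < 1.
  move: htc; rewrite t_c_affinity// -/H.
  have [->|Hn0] := eqVneq H 0; first by rewrite [t * 0]mulr0 ltr01.
  have Hpos : 0 < H by rewrite lt0r Hn0.
  by rewrite ltr_pdivlMr ?mulr_gt0// mulrCA gtr_pMr.
have [theta theta0 thetaE] : exists2 theta, 0 < theta & 4 * theta = 1 - t * H.
  by exists ((1 - t * H) / 4); [rewrite divr_gt0// subr_gt0 | field].
(* The added 1 makes [B] positive, as it occurs in a denominator of [delta]. *)
pose B := `|llr p q (Some true)| + `|llr p q (Some false)| + 1.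
have B0 : 0 < B by rewrite ltr_wpDl ?addr_ge0.
have hB o : `|llr p q o| <= B.
  case: o => [[]|]; last by rewrite normr0 ltW.
    by rewrite /B -addrA lerDl addr_ge0.
  by rewrite /B addrAC lerDr addr_ge0.
(* Labels count as balanced when their magnetization is at most [delta * n] in absolute value. *)
pose delta := theta / (t * B).
have delta0 : 0 < delta by rewrite divr_gt0// mulr_gt0.
pose K := t * B ^+ 2 / (8 * theta).
(* Four errors are made at most e / 4 each: unbalanced labels, [M^-1], eta = e / 4, and the relative
   variance. The last is divided by 4 eta = e, so [M^-1] and [excess_var] must each be at most e^2 /
   8. *)
apply/cvgr0Pnorm_le => e e0; near=> n.
have n0 : 0 < n%:R :> R by near: n; exact: nbhs_infty_gtr.
have L1 : 1 <= ln (n%:R : R) by near: n; exact: near_ln_ge.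
have L2 : (K + 4 / e) / theta <= ln (n%:R : R) by near: n; exact: near_ln_ge.
have L3 : (K + 8 / e ^+ 2) / theta <= ln (n%:R : R).
  by near: n; exact: near_ln_ge.
have n1 : delta^-1 <= n%:R :> R by near: n; exact: nbhs_infty_ger.
have n2 : 4 / (e * delta ^+ 2) <= n%:R by near: n; exact: nbhs_infty_ger.
have a2 : reveal_rate t n <= 2^-1.
  by near: n; apply: near_reveal_rate_le; rewrite ?invr_gt0.
(* This gives a (t + theta) <= theta, which implies a H (t H + theta) <= theta because 0 <= H <=
   1. *)
have a3 : reveal_rate t n <= theta / (t + theta).
  by near: n; apply: near_reveal_rate_le; rewrite ?divr_gt0// addr_gt0.
have a4 : reveal_rate t n <= e ^+ 2 / 8 / (4 * (expR B ^+ 2 + 2)).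
  near: n; apply: near_reveal_rate_le => //.
  apply: divr_gt0; first by rewrite divr_gt0 ?exprn_gt0.
  by rewrite mulr_gt0// addr_gt0// exprn_gt0// expR_gt0.
set a := reveal_rate t n in a2 a3 a4 *.
set L := ln n%:R in L1 L2 L3.
have L0 : 0 < L by exact: lt_le_trans L1.
have a0 : 0 <= a by rewrite divr_ge0 ?mulr_ge0 ?(ltW ht) ?(ltW L0).
have ha : 0 <= a < 1 by rewrite a0 (le_lt_trans a2)// invf_lt1// ltr1n.
have aH : a * H <= a by rewrite ler_piMr.
have recovery_ge0 : 0 <= recovery_prob p q a (sigma_hat n).
  rewrite recovery_probE; apply: sumr_ge0 => s _.
  rewrite mulr_ge0 ?exprn_ge0 ?invr_ge0//.
  by apply: expect_ge0 => *; rewrite ?obs_law_ge0 ?est_kernel_ge0.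
rewrite ger0_norm//.
pose M := expR (theta * L - K).
have largeM X : (K + X) / theta <= L -> X <= M.
  rewrite ler_pdivrMr// mulrC -lerBrDl => XL; apply: le_trans XL _.
  by apply: le_trans (expR_ge1Dx _); rewrite lerDr.
have M1 : M^-1 <= e / 4.
  rewrite -[leRHS]invf_div lef_pV2 ?posrE ?divr_gt0 ?expR_gt0//.
  exact: largeM.
have M2 : M^-1 <= e ^+ 2 / 8.
  rewrite -[leRHS]invf_div lef_pV2 ?posrE ?divr_gt0 ?exprn_gt0 ?expR_gt0//.
  exact: largeM.
have d0 : 0 < (delta * n%:R) ^+ 2 by rewrite exprn_gt0// mulr_gt0.
have eta0 : 0 < e / 4 by rewrite divr_gt0.
have c0 : 0 < 4 * theta * L by rewrite !mulr_gt0.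
have hM : M <= n%:R * (geo_mass p q a ^+ n * expR (- (4 * theta * L / 4 +
    (n%:R * (tilted_rate p q a * B ^+ 2) +
      (tilted_rate p q a * B) ^+ 2 * (2 * (delta * n%:R) ^+ 2 + 2)) /
    (4 * (4 * theta * L))))).
  apply: (expR_exponent_le n L t H B theta a (geo_mass p q a)) => //.
  - by rewrite lnK.
  - rewrite /geo_mass -/H lerBrDr -lerBrDl (le_trans aH)//.
    apply: le_trans a2 _; rewrite le_eqVlt; apply/orP; left; apply/eqP.
    by field.
  - move: a3; rewrite ler_pdivlMr ?addr_gt0//; apply: le_trans.
    apply: ler_pM => //; first exact: mulr_ge0.
      by rewrite addr_ge0 ?mulr_ge0 ?(ltW ht) ?(ltW theta0).
    by rewrite lerD2r ler_piMr// ltW.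
  - by rewrite -/delta exprn_ege1// -ler_pdivrMl// mulr1.
apply: le_trans (recovery_prob_le p q a n hp hq ha B hB (sigma_hat n)
  _ _ _ _ c0 d0 eta0 (expR_gt0 _) hM) _.
clearbody delta.
have first_term : n%:R / (delta * n%:R) ^+ 2 <= e / 4.
  rewrite (_ : _ / _ = (delta ^+ 2 * n%:R)^-1); last first.
    by field; rewrite !gt_eqF.
  rewrite -[leRHS]invf_div lef_pV2 ?posrE ?divr_gt0 ?mulr_gt0 ?exprn_gt0//.
  move: n2; rewrite !ler_pdivrMr ?mulr_gt0 ?exprn_gt0//.
  by rewrite [e * _]mulrC mulrA [n%:R * _]mulrC.
have last_term : (M^-1 + excess_var a B) / (4 * (e / 4)) <= e / 4.
  rewrite [4 * _]mulrC divfK ?pnatr_eq0// ler_pdivrMr//.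
  have -> : e / 4 * e = e ^+ 2 / 8 + e ^+ 2 / 8 by field.
  apply: lerD => //; apply: le_trans (excess_var_le _ _ _) _.
    by rewrite a0.
  by rewrite -ler_pdivlMr// mulr_gt0// addr_gt0// exprn_gt0// expR_gt0.
apply: le_trans (lerD first_term (lerD M1 (lerD (lexx (e / 4)) last_term))) _.
by rewrite le_eqVlt; apply/orP; left; apply/eqP; field.
Unshelve. all: by end_near. Qed.
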